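(* Let $m>0$, $p>1$ satisfy $m(p-1)>1$, let $r\ge 0$, and let $b,d$ satisfy conditions (H$_1$) and (H$_2$) stated in the context. Let $\phi$ be the sharp type traveling wave of problem (TW) of the context (unique up to shift, with the minimal speed $c=c^*(m,p,r)$). If $m\ge\frac{p}{p-1}$, then $\phi$ is not $C^1$ smooth on $\mathbb R$; while if $m\in\big(\frac1{p-1},\frac p{p-1}\big)$, then $\phi$ is $C^1$ smooth on $\mathbb R$.
   Context: Consider the doubly nonlinear diffusion equation with time delay $$\frac{\partial u}{\partial t}=\Big(\big|(u^m)_x\big|^{p-2}(u^m)_x\Big)_x-d(u)+b(u(t-r,x)),\quad x\in\mathbb R,\ t>0,$$ where $r\ge0$ is the time delay. Conditions on $b,d$: (H$_1$) The constant equilibria are exactly the two values $u_-=0$ and $u_+=:K>0$: $d(0)=b(0)=0$, $d(K)=b(K)$ (and $b(s)\ne d(s)$ for $s\in(0,K)$), with $b'(0)>d'(0)\ge0$ and $d'(K)>b'(K)\ge0$. (H$_2$) $d,b\in C^2([0,K])$ and $b'(s)>0$, $d'(s)>0$ for $s\in[0,K]$. Problem (TW): for $c>0$, a traveling wave $u(t,x)=\phi(\xi)$ with $\xi=x+ct$ (with $\xi$ written as $t$) satisfies $$c\phi'(t)=\big(|(\phi^m)'(t)|^{p-2}(\phi^m)'(t)\big)'-d(\phi(t))+b(\phi(t-cr)),\quad t\in\mathbb R,\qquad \phi(-\infty)=0,\ \phi(+\infty)=K.$$ A function $\phi$ is a traveling wave solution of (TW) with speed $c$ if $\phi$ is bounded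 and uniformly continuous on $\mathbb R$, $0\le\phi(t)\le K$, $\phi(-\infty)=0$, $\phi(+\infty)=K$, $\phi^m\in W^{1,p}_{\mathrm{loc}}(\mathbb R)$, and the differential equation in (TW) holds in the sense of distributions. It is of sharp type if $\operatorname{supp}\phi=[t_0,+\infty)$ for some $t_0\in\mathbb R$ and $\phi(t)>0$ for $t>t_0$. The minimal wave speed is $c^*(m,p,r):=\inf\{c>0:\text{(TW) admits an increasing traveling wave solution with speed }c\}$. Under the hypotheses of the claim, (TW) has a sharp type traveling wave exactly for the speed $c=c^*(m,p,r)>0$, and this sharp wave is unique up to shift and monotonically increasing. *)

(* Defs.v *)
From HB Require Import structures.
From mathcomp Require Import all_boot all_order all_algebra.
From mathcomp Require Import all_classical all_reals all_analysis.

Set Implicit Arguments.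
Unset Strict Implicit.
Unset Printing Implicit Defensive.

Import Order.TTheory GRing.Theory Num.Theory.
Import numFieldNormedType.Exports.

Local Open Scope classical_set_scope.
Local Open Scope ring_scope.

(* Derivative at x relative to a set A: one-sided at the endpoints when A is a
   closed interval, and insensitive to the values of f outside A (for x in A). *)
Definition derivable_in (R : realType) (A : set R) (f : R -> R) (x : R) : Prop :=
  cvg ((f y - f x) / (y - x) @[y --> within A x^']).

Definition derive1_in (R : realType) (A : set R) (f : R -> R) (x : R) : R :=
  lim ((f y - f x) / (y - x) @[y --> within A x^']).

Definition C2_in (R : realType) (A : set R) (f : R -> R) : Prop :=
  [/\ forall x, A x -> derivable_in A f x,
      forall x, A x -> derivable_in A (derive1_in A f) x &
      {within A, continuous (derive1_in A (derive1_in A f))}].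

Definition C1_smooth (R : realType) (f : R -> R) : Prop :=
  (forall x : R, derivable f x 1) /\ continuous (derive1 f).

Record conditionH1 (R : realType) (K : R) (b d : R -> R) : Prop := {
  H1_K_gt0 : 0 < K;
  H1_eq0 : d 0 = 0 /\ b 0 = 0;
  H1_eqK : d K = b K;
  H1_neq : forall s, 0 < s < K -> b s <> d s;
  H1_der0 : 0 <= derive1_in `[0, K] d 0 < derive1_in `[0, K] b 0;
  H1_derK : 0 <= derive1_in `[0, K] b K < derive1_in `[0, K] d K
}.

Record conditionH2 (R : realType) (K : R) (b d : R -> R) : Prop := {
  H2_C2 : C2_in `[0, K] d /\ C2_in `[0, K] b;
  H2_incr : forall s, 0 <= s <= K ->
    0 < derive1_in `[0, K] b s /\ 0 < derive1_in `[0, K] d s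
}.

Definition fun_support (R : realType) (f : R -> R) : set R :=
  closure [set x | f x != 0].

Record test_function (R : realType) (psi : R -> R) : Prop := {
  test_smooth : forall (n : nat) (x : R), derivable (derive1n n psi) x 1;
  test_compact : compact (fun_support psi)
}.

Definition locally_Lp (R : realType) (p : R) (f : R -> R) : Prop :=
  forall A : set R, compact A -> f \_ A \in Lfun (@lebesgue_measure R) p%:E.

Definition weak_derivative (R : realType) (v w : R -> R) : Prop :=
  forall psi, test_function psi ->
    (\int[@lebesgue_measure R]_x (v x * derive1 psi x) =
     - (\int[@lebesgue_measure R]_x (w x * psi x)))%R.

(* v belongs to W^{1,p}_loc, with weak derivative w. *)
Definition sobolev1_loc (R : realType) (p : R) (v w : R -> R) : Prop :=
  [/\ locally_Lp p v, locally_Lp p w & weak_derivative v w].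

(* c phi' = (|w|^{p-2} w)' - d(phi) + b(phi(. - c r)) in the sense of
   distributions; w stands for the weak derivative of phi^m.  At a zero of w the
   product |w|^{p-2} w is 0, also when p <= 2, whatever the value of powR. *)
Definition tw_equation (R : realType) (p r c : R) (b d phi w : R -> R) : Prop :=
  forall psi, test_function psi ->
    (- (c * \int[@lebesgue_measure R]_t (phi t * derive1 psi t)) =
     - (\int[@lebesgue_measure R]_t (`|w t| `^ (p - 2) * w t * derive1 psi t))
     + (\int[@lebesgue_measure R]_t
          ((b (phi (t - c * r)) - d (phi t)) * psi t)))%R.

Record traveling_wave (R : realType) (m p r K : R) (b d : R -> R)
    (c : R) (phi : R -> R) : Prop := {
  tw_bounded : bounded_fun phi;
  tw_unif_continuous : unif_continuous phi;
  tw_range : forall t, 0 <= phi t <= K;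
  tw_ninfty : phi t @[t --> -oo] --> (0 : R);
  tw_pinfty : phi t @[t --> +oo] --> K;
  tw_weak : exists w : R -> R,
    sobolev1_loc p (fun t => phi t `^ m) w /\ tw_equation p r c b d phi w
}.

Definition sharp_type (R : realType) (phi : R -> R) : Prop :=
  exists t0 : R, fun_support phi = `[t0, +oo[%classic /\ forall t, t0 < t -> 0 < phi t.

(* "Increasing" is meant in the wide sense: sharp waves vanish on a half-line.
   The infimum is a real-valued inf, hence 0 if no admissible speed exists. *)
Definition minimal_wave_speed (R : realType) (m p r K : R) (b d : R -> R) : R :=
  inf [set c | 0 < c /\
    exists2 phi : R -> R, traveling_wave m p r K b d c phi &
      {homo phi : s t / s <= t}].

(* Main.v *)
Require Import Defs.
From HB Require Import structures.
From mathcomp Require Import all_boot all_order all_algebra.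
From mathcomp Require Import all_classical all_reals all_analysis.
From mathcomp Require Import measurable_realfun ring lra.
Set Implicit Arguments.
Unset Strict Implicit.
Unset Printing Implicit Defensive.
Import Order.TTheory GRing.Theory Num.Theory.
Import numFieldNormedType.Exports.
Local Open Scope classical_set_scope.
Local Open Scope ring_scope.

(** Write [v = phi ^ m], let [w] be its weak derivative, [F = |w|^(p-2) w] the
flux and [S y = sgn y |y|^(1/(p-1))] the inverse of [w |-> F].

Integrating the equation once gives [F = c phi + H] almost everywhere, where
[H] is a primitive of the continuous function [d(phi) - b(phi(. - c r))].
Hence [w = S (c phi + H)] almost everywhere; the right-hand side is continuous,
so that [v] is [C^1] with [v' = S (c phi + H)] everywhere
([wave_regularity]).  Both integrations are instances of the lemma of
du Bois-Reymond ([du_bois_reymond]).  On the left of the front [t0] everything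
vanishes, which fixes the constant: [H = 0] on [(-oo, t0]]
([flux_constant_eq0]).

On the right of the front the term [c phi] dominates [H] ([flux_estimate]): if
[s] is a maximum point of [phi] on [[t0, t]], then [H s] is at most a small
multiple of [phi s], because [|H'| <= L phi s] there; so [v'(s) > 0] and [s]
cannot lie inside the interval, that is [s = t].  Consequently
[v' = (c phi)^(1/(p-1))] up to constant factors, and
[phi' = m^-1 phi^(1-m) v'] is comparable with [phi ^ (p/(p-1) - m)] on a right
neighbourhood of [t0] ([wave_slope_bounds]).

The sign of the exponent [p/(p-1) - m] decides.  If it is at most [0], then
[phi'] is bounded below by a positive constant to the right of [t0] but is [0] to
the left ([not_C1_of_slope_gap]).  If it is positive, then [phi'] tends to [0] at
the front and [phi] is [C^1] ([C1_of_slope_vanishing]). *)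

(** * Smooth functions and a smooth step *)

(** The multiplicative form of the definition of a derivative avoids division when
[f] is only bounded by estimates near [a]. *)
Lemma is_derive1_eps (R : realType) (f : R -> R) (a l : R) :
  (forall e, 0 < e -> \forall x \near a,
     `|f x - f a - l * (x - a)| <= e * `|x - a|) ->
  is_derive a 1 f l.
Proof.
move=> H; suff cf : h^-1 *: (f (h *: 1 + a) - f a) @[h --> 0^'] --> l.
  by split; [apply/cvg_ex; exists l|exact: cvg_lim cf].
apply/cvgrPdist_le => e e0.
have /nbhs_ballP[d /= d0 Hd] := H e e0.
rewrite /nbhs /= /within /=; apply/nbhs_ballP; exists d => //= h.
rewrite /ball /= sub0r normrN => hd h0.
have /Hd : ball a d (h + a) by rewrite /ball /= opprD addrCA subrr addr0 normrN.
rewrite addrK [_ *: 1]mulr1 => Hh.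
have -> : l - h^-1 *: (f (h + a) - f a) = - (h^-1 * (f (h + a) - f a - l * h)).
  by rewrite /GRing.scale /= (mulrBr _ _ (l * h)) (mulrCA _ l) mulVf// mulr1 opprB.
by rewrite normrN normrM normfV mulrC ler_pdivrMr ?normr_gt0.
Qed.

Section smooth.
Context {R : realType}.
Implicit Types f g : R -> R.

(** Peeling off one derivative at a time makes the closure lemmas below plain
inductions on [n], with no Leibniz formula for higher derivatives. *)
Fixpoint smooth_upto (n : nat) f : Prop :=
  if n is k.+1 then (forall x, derivable f x 1) /\ smooth_upto k (derive1 f)
  else True.

Definition smooth f := forall n, smooth_upto n f.

Lemma smooth_uptoW n f : smooth_upto n.+1 f -> smooth_upto n f.
Proof.
elim: n f => [//|n IH] f [df sf]; split => //; exact: IH.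
Qed.

Lemma smooth_derive f (x : R) : smooth f -> is_derive x 1 f (derive1 f x).
Proof. by move=> /(_ 1%N)[df _]; rewrite derive1E; exact: derivableP. Qed.

Lemma smooth_derive1 f : smooth f -> smooth (derive1 f).
Proof. by move=> sf n; have [] := sf n.+1. Qed.

Lemma smooth_derive1n f n (x : R) : smooth f -> derivable (derive1n n f) x 1.
Proof.
move=> /(_ n.+1); rewrite /derive1n; elim: n f => [f [df _]|n IH f [_ sf]].
  exact: df.
by rewrite iterSr; apply: IH.
Qed.

Lemma smooth_uptoS n f df : (forall x : R, is_derive x 1 f (df x)) ->
  smooth_upto n df -> smooth_upto n.+1 f.
Proof.
move=> fdf sdf; split; first by move=> x; exact: ex_derive.
rewrite (_ : f^`()%classic = df)//; apply/funext => x.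
by rewrite derive1E; exact: derive_val.
Qed.

Lemma smooth_upto_derive n f (x : R) : smooth_upto n.+1 f ->
  is_derive x 1 f (derive1 f x).
Proof. by move=> [df _]; rewrite derive1E; exact: derivableP. Qed.

Lemma smooth_upto_cst n (k : R) : smooth_upto n (fun=> k).
Proof.
elim: n k => [//|n IH] k; exact: (@smooth_uptoS _ _ (fun=> 0)).
Qed.

Lemma smooth_uptoD n f g : smooth_upto n f -> smooth_upto n g ->
  smooth_upto n (fun x => f x + g x).
Proof.
elim: n f g => [//|n IH] f g sf sg.
apply: (@smooth_uptoS _ _ (fun x => derive1 f x + derive1 g x)).
  move=> x; have := smooth_upto_derive x sf; have := smooth_upto_derive x sg.
  by move=> ? ?; exact: is_deriveD.
by apply: IH; [exact: (proj2 sf)|exact: (proj2 sg)].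
Qed.

Lemma smooth_uptoM n f g : smooth_upto n f -> smooth_upto n g ->
  smooth_upto n (fun x => f x * g x).
Proof.
elim: n f g => [//|n IH] f g sf sg.
apply: (@smooth_uptoS _ _ (fun x => f x * derive1 g x + g x * derive1 f x)).
  move=> x; have := smooth_upto_derive x sf; have := smooth_upto_derive x sg.
  by move=> ? ?; exact: is_deriveM.
by apply: smooth_uptoD; apply: IH;
  rewrite ?(proj2 sf) ?(proj2 sg)//;
  [exact: smooth_uptoW|exact: (proj2 sg)|exact: smooth_uptoW|exact: (proj2 sf)].
Qed.

(** [(1/f)' = - (1/f) (1/f) f'] is a product of functions known to be smooth one
order below. *)
Lemma smooth_uptoV n f : (forall x, f x != 0) -> smooth_upto n f ->
  smooth_upto n (fun x => (f x)^-1).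
Proof.
move=> f0; elim: n => [//|n IH] sf.
have sV := IH (smooth_uptoW sf).
apply: (@smooth_uptoS _ _ (fun x => -1 * ((f x)^-1 * ((f x)^-1 * derive1 f x)))).
  move=> x; have df := smooth_upto_derive x sf.
  have := is_deriveV (f0 x) df => /is_derive_eq; apply.
  rewrite /GRing.scale /= expr2 invfM; ring.
apply: smooth_uptoM; first exact: smooth_upto_cst.
by apply: smooth_uptoM => //; apply: smooth_uptoM => //; exact: (proj2 sf).
Qed.

Lemma smooth_upto_affine n f (k l : R) : smooth_upto n f ->
  smooth_upto n (fun x => f (k * x + l)).
Proof.
elim: n f => [//|n IH] f sf.
apply: (@smooth_uptoS _ _ (fun x => k * derive1 f (k * x + l))).
  move=> x; have df := smooth_upto_derive (k * x + l) sf.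
  have da : is_derive x 1 (fun x : R => k * x + l) k.
    have := is_deriveD (is_deriveZ k (@is_derive_id _ _ x 1)) (@is_derive_cst _ _ _ l x 1).
    by move/is_derive_eq; apply; rewrite addr0 [_ *: 1]mulr1.
  have := @is_derive1_comp _ f (fun x : R => k * x + l) x _ _ df da.
  move/is_derive_eq; apply; ring.
by apply: smooth_uptoM; [exact: smooth_upto_cst|exact: IH (proj2 sf)].
Qed.

(** The functions [x ^- k exp(-1/x)], extended by [0] to [x <= 0]; differentiating
one of them gives a combination of two others. *)
Definition flat (k : nat) (x : R) : R :=
  if 0 < x then x^-1 ^+ k * expR (- x^-1) else 0.

(** With [y = 1/x], this is [exp y = exp(y/(k+1)) ^ (k+1) >= (y/(k+1)) ^ (k+1)].  A
linear bound is what the derivative at [0] needs. *)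
Lemma flat_le k x : `|flat k x| <= k.+1%:R ^+ k.+1 * `|x|.
Proof.
rewrite /flat; case: ifPn => x0; last by rewrite normr0 mulr_ge0// exprn_ge0.
rewrite ger0_norm ?mulr_ge0 ?expR_ge0 ?exprn_ge0 ?invr_ge0 ?(ltW x0)//.
rewrite (gtr0_norm x0) expRN ler_pdivrMr ?expR_gt0//.
set y := x^-1; have y0 : 0 < y by rewrite invr_gt0.
have -> : expR y = expR (y / k.+1%:R) ^+ k.+1.
  by rewrite -expRM_natl mulrC divfK// pnatr_eq0.
have : (y / k.+1%:R) ^+ k.+1 <= expR (y / k.+1%:R) ^+ k.+1.
  apply: lerXn2r; rewrite ?nnegrE ?expR_ge0 ?divr_ge0 ?(ltW y0)//.
  by rewrite (le_trans _ (expR_ge1Dx _))// lerDr.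
have k0 : 0 < k.+1%:R ^+ k.+1 :> R by rewrite exprn_gt0// ltr0n.
rewrite expr_div_n ler_pdivrMr// => H.
apply: le_trans (_ : y ^+ k.+1 * x <= _).
  by rewrite exprSr -mulrA mulVf ?gt_eqF// mulr1.
rewrite [leRHS](_ : _ = (expR (y / k.+1%:R) ^+ k.+1 * k.+1%:R ^+ k.+1) * x).
  by rewrite ler_wpM2r// ltW.
ring.
Qed.

Lemma is_derive_flat k (x : R) :
  is_derive x 1 (flat k) (- k%:R * flat k.+1 x + flat k.+2 x).
Proof.
have [x0|x0|->] := ltgtP x 0.
- rewrite [flat k.+1 x]/flat [flat k.+2 x]/flat ltNge (ltW x0) /= mulr0 addr0.
  apply: (@near_eq_is_derive _ _ _ (cst 0)).
    near=> y; rewrite /= /flat ltNge ifF//; apply/negbTE; rewrite negbK ltW//.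
    by near: y; exact: lt_nbhsl.
- rewrite [flat k.+1 x]/flat [flat k.+2 x]/flat x0.
  apply: (@near_eq_is_derive _ _ _ (fun y : R => y^-1 ^+ k * expR (- y^-1))).
  + by near=> y; rewrite /flat ifT//; near: y; exact: lt_nbhsr.
  + have dV : is_derive x 1 (fun y : R => y^-1) (- (x ^- 2)).
      have := is_deriveV (lt0r_neq0 x0) (@is_derive_id _ _ x 1).
      by move/is_derive_eq; apply; rewrite /GRing.scale /= mulr1.
    have dN : is_derive x 1 (fun y : R => - y^-1) (x ^- 2).
      by have := is_deriveN dV; move/is_derive_eq; apply; rewrite opprK.
    have dE := @is_derive1_comp _ expR (fun y : R => - y^-1) x _ _ (is_derive_expR _) dN.
    have dX := @is_deriveX _ _ (fun y : R => y^-1) k x 1 _ dV.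
    rewrite (_ : (fun _ => _) =
        (fun y : R => y^-1) ^+ k * (expR \o (fun y : R => - y^-1))); last first.
      by apply/funext => y; rewrite !fctE.
    have := is_deriveM dX dE.
    move/is_derive_eq; apply; rewrite !fctE /= /GRing.scale /=.
    case: k {dX} => [|k] /=.
      by rewrite !mulr0n !mul0r !oppr0 !expr0 ?mul0r ?mulr0 ?addr0 ?add0r !mul1r exprVn mulrC.
    rewrite -mulr_natl !exprS !exprVn; field.
    by rewrite expf_neq0 lt0r_neq0.
- rewrite [flat k.+1 0]/flat [flat k.+2 0]/flat ltxx mulr0 addr0.
  apply: is_derive1_eps => e e0; rewrite [flat k 0]/flat ltxx.
  have C0 : 0 < k.+2%:R ^+ k.+2 :> R by rewrite exprn_gt0// ltr0n.
  near=> y; rewrite mul0r !subr0.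
  have -> : flat k y = y * flat k.+1 y.
    rewrite /flat; case: ifPn => y0; rewrite ?mulr0// exprS !mulrA divff ?mul1r//.
    by rewrite lt0r_neq0.
  rewrite normrM mulrC ler_wpM2r// (le_trans (flat_le _ _))//.
  rewrite mulrC -ler_pdivlMr//; near: y.
  by apply: cvgr0_norm_le; [exact: cvg_id|rewrite divr_gt0].
Unshelve. all: by end_near. Qed.

Lemma smooth_flat k : smooth (flat k).
Proof.
move=> n; elim: n k => [//|n IH] k.
apply: (@smooth_uptoS _ _ (fun x => - k%:R * flat k.+1 x + flat k.+2 x)).
  exact: is_derive_flat.
by apply: smooth_uptoD => //; apply: smooth_uptoM => //; exact: smooth_upto_cst.
Qed.

(** A smooth transition from [0] on [x <= 0] to [1] on [x >= 1]. *)
Definition smooth_step (x : R) : R := flat 0 x / (flat 0 x + flat 0 (1 - x)).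

Lemma flat0_ge0 x : 0 <= flat 0 x.
Proof. by rewrite /flat; case: ifP => //; rewrite expr0 mul1r expR_ge0. Qed.

Lemma flat0_gt0 x : 0 < x -> 0 < flat 0 x.
Proof. by rewrite /flat => ->; rewrite expr0 mul1r expR_gt0. Qed.

Lemma smooth_smooth_step : smooth smooth_step.
Proof.
move=> n; apply: smooth_uptoM; first exact: smooth_flat.
apply: smooth_uptoV => [x|].
  rewrite gt_eqF//; have [x0|x0] := ltP 0 x.
    by rewrite ltr_pwDl ?flat0_ge0 ?flat0_gt0.
  by rewrite ltr_wpDl ?flat0_ge0 ?flat0_gt0//; lra.
apply: smooth_uptoD; first exact: smooth_flat.
rewrite (_ : (fun _ => _) = (fun x => flat 0 (-1 * x + 1))).
  exact/smooth_upto_affine/smooth_flat.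
by apply/funext => x; congr flat; ring.
Qed.

Lemma smooth_step0 x : x <= 0 -> smooth_step x = 0.
Proof. by move=> x0; rewrite /smooth_step {1}/flat ltNge x0 mul0r. Qed.

Lemma smooth_step1 x : 1 <= x -> smooth_step x = 1.
Proof.
move=> x1; rewrite /smooth_step {3}/flat ltNge subr_le0 x1 addr0 divff//.
by rewrite gt_eqF// flat0_gt0//; lra.
Qed.

End smooth.

(** * Integrals of functions with compact support *)

Section calculus.
Context {R : realType}.
Local Notation mu := (@lebesgue_measure R).
Implicit Types f g h psi : R -> R.

Lemma is_derive_continuous f df : (forall x : R, is_derive x 1 f (df x)) ->
  continuous f.
Proof.
move=> H x; apply: differentiable_continuous; apply/derivable1_diffP.
exact: ex_derive.
Qed.

Lemma smooth_continuous f : smooth f -> continuous f.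
Proof. by move=> sf; apply: is_derive_continuous => x; exact: smooth_derive. Qed.

Lemma continuous_locally_integrable f : continuous f -> locally_integrable setT f.
Proof.
move=> cf; split => [||A _ cA].
- exact: continuous_measurable_fun.
- exact: openT.
- have := @continuous_compact_integrable R f A cA (continuous_subspaceT cf).
  by case/integrableP.
Qed.

Lemma locally_integrable_compact f (A : set R) : locally_integrable setT f ->
  compact A -> mu.-integrable A (EFin \o f).
Proof.
move=> [mf _ lf] cA; apply/integrableP; split; last exact: lf.
apply/measurable_EFinP; apply: measurable_funS mf => //.
Qed.

Lemma derivable_oo f df (a b : R) : (forall x : R, is_derive x 1 f (df x)) ->
  derivable_oo_LRcontinuous f a b.
Proof.
move=> fdf; have cf := is_derive_continuous fdf; split.
- by move=> x _; exact: ex_derive.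
- exact/cvg_at_right_filter/cf.
- exact/cvg_at_left_filter/cf.
Qed.

Lemma derive1_is f df : (forall x : R, is_derive x 1 f (df x)) -> derive1 f =1 df.
Proof. by move=> fdf x; rewrite derive1E; exact: derive_val. Qed.

Lemma Rintegral_derive f df (a b : R) : (a < b)%R ->
  (forall x : R, is_derive x 1 f (df x)) -> continuous df ->
  \int[mu]_(x in `[a, b]) df x = f b - f a.
Proof.
move=> ab fdf cdf; rewrite /Rintegral.
rewrite (@continuous_FTC2 R df f a b ab (continuous_subspaceT cdf)
  (derivable_oo a b fdf)) //.
by move=> x _; exact: derive1_is.
Qed.

Lemma Rintegral_support f (A : set R) : (forall x, ~ A x -> f x = 0) ->
  \int[mu]_x f x = \int[mu]_(x in A) f x.
Proof.
move=> fA; rewrite [RHS]Rintegral_mkcond; congr Rintegral; apply/funext => x.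
rewrite patchE; case: ifPn => // xA; apply: fA => Ax.
by move: xA; rewrite mem_set.
Qed.

Lemma integrable_support f (A : set R) : measurable A ->
  (forall x, ~ A x -> f x = 0) ->
  mu.-integrable A (EFin \o f) -> mu.-integrable setT (EFin \o f).
Proof.
move=> mA fA intf; have := (@integrable_mkcond _ _ _ mu A (EFin \o f) mA).1 intf.
congr (is_true (mu.-integrable _ _)).
apply/funext => x; rewrite patchE; case: ifPn => //= xA; rewrite fA// => Ax.
by move: xA; rewrite mem_set.
Qed.

Lemma Rintegral_by_parts f g df dg (a b : R) : (a < b)%R ->
  (forall x : R, is_derive x 1 f (df x)) -> continuous df ->
  (forall x : R, is_derive x 1 g (dg x)) -> continuous dg ->
  g a = 0 -> g b = 0 ->
  \int[mu]_(x in `[a, b]) (f x * dg x) = - \int[mu]_(x in `[a, b]) (df x * g x).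
Proof.
move=> ab fdf cdf gdg cdg ga gb.
rewrite (@Rintegration_by_parts R f g df dg a b ab) ?ga ?gb ?mulr0 ?subrr ?sub0r//.
- exact: continuous_subspaceT.
- exact: derivable_oo fdf.
- by move=> x _; exact: derive1_is.
- exact: continuous_subspaceT.
- exact: derivable_oo gdg.
- by move=> x _; exact: derive1_is.
Qed.

Definition bump_function psi :=
  smooth psi /\ exists N : R, 0 < N /\ forall x, N < `|x| -> psi x = 0.


Lemma derive1_near_cst f (x k : R) : (\forall y \near x, f y = k) ->
  derive1 f x = 0.
Proof.
move=> fk; rewrite derive1E; apply: (@derive_val _ _ _ x 1 f 0).
apply: (@near_eq_is_derive _ _ _ (cst k)).
by apply: filterS fk => y ->.
Qed.

Lemma derive1_outside psi (N x : R) : (forall x, N < `|x| -> psi x = 0) ->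
  N < `|x| -> derive1 psi x = 0.
Proof.
move=> psiN Nx; apply: (@derive1_near_cst _ _ 0).
near=> y; apply: psiN; near: y.
have : `|y| @[y --> x] --> `|x| by apply: cvg_norm; exact: cvg_id.
by move/cvgr_gt; apply.
Unshelve. all: by end_near. Qed.

Lemma bump_test_function psi : bump_function psi -> test_function psi.
Proof.
move=> [sp [N [N0 pN]]]; split; first by move=> n x; exact: smooth_derive1n.
apply: (@subclosed_compact _ _ `[- N, N]); first exact: closed_closure.
  exact: segment_compact.
have /closure_id -> : closed `[- N, N]%classic by exact: interval_closed.
apply: closure_subset => x /=; apply: contraNP => xN; apply/eqP; apply: pN.
by rewrite ltNge; apply/negP; rewrite ler_norml; move: xN; rewrite in_itv.
Qed.

Lemma bounded_compact_support psi (N : R) : continuous psi ->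
  (forall x, N < `|x| -> psi x = 0) ->
  exists C : R, 0 < C /\ forall x, `|psi x| <= C.
Proof.
move=> cp pN.
have [N0|N0] := ltP N 0.
  by exists 1; split => // x; rewrite pN ?normr0// (lt_le_trans N0).
have NN : - N <= N by rewrite (le_trans _ N0)// oppr_le0.
have cn : {within `[- N, N], continuous (fun x => `|psi x|)}.
  apply: continuous_subspaceT => x; apply: cvg_norm; exact: cp.
have [c _ cmax] := EVT_max NN cn.
exists (`|psi c| + 1); split; first by rewrite ltr_wpDl.
move=> x; have [Nx|xN] := ltP N `|x|.
  by rewrite pN// normr0 addr_ge0.
by rewrite (le_trans (cmax x _)) ?lerDl// in_itv/= -ler_norml.
Qed.

Lemma outside_itv psi (N x : R) : (forall x, N < `|x| -> psi x = 0) ->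
  ~ `[- N, N]%classic x -> psi x = 0.
Proof.
by move=> pN xN; apply: pN; rewrite ltNge ler_norml; apply/negP; move: xN; rewrite /= in_itv.
Qed.

Lemma integrable_mul_bounded f psi (A : set R) (C : R) : measurable A ->
  (forall x, `|psi x| <= C) -> measurable_fun setT f -> continuous psi ->
  mu.-integrable A (EFin \o f) ->
  mu.-integrable A (EFin \o (fun x => f x * psi x)).
Proof.
move=> mA pC mf cp intf; have C0 : 0 <= C by exact: le_trans (pC 0).
apply: (@le_integrable _ _ _ mu A mA _ (fun x => C%:E * (f x)%:E)%E).
- apply/measurable_EFinP; apply: measurable_funM.
    exact: measurable_funS mf.
  by apply: measurable_funS (continuous_measurable_fun cp).
- move=> x _; rewrite /= lee_fin !normrM mulrC ler_wpM2r//.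
  by rewrite (ger0_norm C0).
- exact: (@integrableZl _ _ _ mu _ mA C).
Qed.

Lemma integrable_mul_support f psi (N : R) : locally_integrable setT f ->
  continuous psi -> (forall x, N < `|x| -> psi x = 0) ->
  mu.-integrable setT (EFin \o (fun x => f x * psi x)).
Proof.
move=> lf cp pN; have [C [_ pC]] := bounded_compact_support cp pN.
have mA : measurable `[- N, N]%classic by exact: measurable_itv.
apply: (integrable_support mA) => [x xN|].
  by rewrite (outside_itv pN)// mulr0.
apply: (integrable_mul_bounded mA pC) => //; first by case: lf.
exact: locally_integrable_compact (@segment_compact _ _ _).
Qed.

(** The boundary terms vanish on an interval exceeding the support. *)
Lemma Rintegral_by_parts_bump h dh psi : (forall x : R, is_derive x 1 h (dh x)) ->
  continuous dh -> bump_function psi ->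
  \int[mu]_x (h x * derive1 psi x) = - \int[mu]_x (dh x * psi x).
Proof.
move=> hdh cdh [sp [N [N0 pN]]].
have pN1 x : N + 1 < `|x| -> psi x = 0.
  by move=> Nx; apply: pN; rewrite (lt_trans _ Nx)// ltrDl.
rewrite (@Rintegral_support _ `[- (N + 1), N + 1]); last first.
  move=> x xN; rewrite (@outside_itv (derive1 psi) (N + 1) _ _ xN) ?mulr0// => y Ny.
  exact: derive1_outside Ny.
rewrite [in RHS](@Rintegral_support _ `[- (N + 1), N + 1]); last first.
  by move=> x xN; rewrite (outside_itv pN1 xN) mulr0.
apply: Rintegral_by_parts => //.
- by rewrite gtrN// addr_gt0.
- by move=> x; exact: smooth_derive.
- exact/smooth_continuous/smooth_derive1.
- by apply: pN; rewrite normrN gtr0_norm ?addr_gt0// ltrDl.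
- by apply: pN; rewrite gtr0_norm ?addr_gt0// ltrDl.
Qed.

(** The oriented integral from [0] to [x]; locally it differs by a constant from
[\int_(-N)^x h] with a fixed [N], to which the fundamental theorem applies. *)
Lemma continuous_antiderivative h : continuous h ->
  exists H : R -> R, forall x : R, is_derive x 1 H (h x).
Proof.
move=> ch; pose I a x := \int[mu]_(t in `[a, x]) h t.
have hI (a b : R) : mu.-integrable `[a, b] (EFin \o h).
  exact/locally_integrable_compact/segment_compact/continuous_locally_integrable.
have split3 (a x y : R) : a <= x -> x <= y -> I a y - I a x = I x y.
  move=> ax xy; rewrite /I Rintegral_itvB ?bnd_simp//.
  rewrite Rintegral_itv_obnd_cbnd//.
  apply: integrableS (hI x y) => //.
  by apply: subset_itvr; rewrite bnd_simp.
exists (fun x => I 0 x - I x 0) => x.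
pose N := `|x| + 1.
have xN : - N < x.
  by rewrite ltrNl (le_lt_trans (ler_norm _))// normrN ltrDl.
have N0 : - N < 0 by rewrite oppr_lt0 ltr_wpDl.
apply: (@near_eq_is_derive _ _ _ (fun y => I (- N) y - I (- N) 0)).
  near=> y; have Ny : - N < y by near: y; exact: lt_nbhsr.
  have [y0|y0] := leP y 0.
    rewrite -(split3 (- N) y 0) ?(ltW Ny)//.
    have [->|yn0] := eqVneq y 0; first by rewrite !subrr subr0 /I set_itv1 Rintegral_set1.
    have -> : I 0 y = 0.
      by rewrite /I set_itv_ge ?Rintegral_set0// bnd_simp -ltNge lt_neqAle yn0.
    by ring.
  rewrite -(split3 (- N) 0 y) ?(ltW N0) ?(ltW y0)//.
  by rewrite [I y 0]/I set_itv_ge ?Rintegral_set0 ?subr0// bnd_simp -ltNge.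
have xx1 : x < x + 1 by rewrite ltrDl.
have [dI <-] := continuous_FTC1_closed xx1 (hI (- N) (x + 1)) xN (ch x).
rewrite derive1E.
have := is_deriveB (derivableP dI) (@is_derive_cst _ _ _ (I (- N) 0) x 1).
by rewrite subr0.
Unshelve. all: by end_near. Qed.

End calculus.

(** * Mollification at a Lebesgue point *)

Section mollification.
Context {R : realType}.
Local Notation mu := (@lebesgue_measure R).
Implicit Types f g h psi : R -> R.

(** The derivative in [x] of the rescaled step [smooth_step ((x - a) / e)]: an
approximate unit mass supported in [[a, a + e]]. *)
Definition mollifier (a e x : R) : R := derive1 smooth_step ((x - a) / e) / e.

Lemma smooth_scaled_step (a e : R) : smooth (fun x => smooth_step ((x - a) / e)).
Proof.
move=> n; rewrite (_ : (fun _ => _) =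
    (fun x => smooth_step (e^-1 * x + (- a / e)))).
  exact/smooth_upto_affine/smooth_smooth_step.
by apply/funext => x; congr smooth_step; ring.
Qed.

Lemma is_derive_scaled_step (a e x : R) :
  is_derive x 1 (fun x => smooth_step ((x - a) / e)) (mollifier a e x).
Proof.
have da : is_derive x 1 (fun x : R => (x - a) / e) e^-1.
  rewrite (_ : (fun _ => _) = (fun x : R => e^-1 * x + (- a / e))); last first.
    by apply/funext => y; ring.
  have := is_deriveD (is_deriveZ e^-1 (@is_derive_id _ _ x 1))
    (@is_derive_cst _ _ _ (- a / e) x 1).
  by move/is_derive_eq; apply; rewrite addr0 [_ *: 1]mulr1.
exact: (@is_derive1_comp _ smooth_step (fun x : R => (x - a) / e) x _ _
  (smooth_derive _ smooth_smooth_step) da).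
Qed.

Lemma derive_step_outside x : ~~ (0 <= x <= 1) -> derive1 (@smooth_step R) x = 0.
Proof.
rewrite negb_and -!ltNge => /orP[x0|x1].
  apply: (@derive1_near_cst _ _ _ 0); near=> y; apply: smooth_step0.
  by apply: ltW; near: y; exact: lt_nbhsl.
apply: (@derive1_near_cst _ _ _ 1); near=> y; apply: smooth_step1.
by apply: ltW; near: y; exact: lt_nbhsr.
Unshelve. all: by end_near. Qed.

Lemma mollifier_outside (a e x : R) : 0 < e -> ~~ (a <= x <= a + e) ->
  mollifier a e x = 0.
Proof.
move=> e0 xa; rewrite /mollifier derive_step_outside ?mul0r//.
apply: contra xa; rewrite ler_pdivlMr// ler_pdivrMr// mul0r mul1r subr_ge0.
by rewrite lerBlDl.
Qed.

Lemma mollifier_ball (a e x : R) : 0 < e -> ~ ball a (e *+ 2) x ->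
  mollifier a e x = 0.
Proof.
move=> e0; rewrite ball_itv/= in_itv/= => xa; apply: mollifier_outside => //.
apply: contra_notN xa => /andP[ax xa]; rewrite mulr2n; apply/andP; split; lra.
Qed.

Lemma continuous_mollifier (a e : R) : continuous (mollifier a e).
Proof.
rewrite (_ : mollifier a e = derive1 (fun x => smooth_step ((x - a) / e))).
  exact/smooth_continuous/smooth_derive1/smooth_scaled_step.
by apply/funext => x; apply/esym/derive1_is => y; exact: is_derive_scaled_step.
Qed.

(** The bound of order [1/e] is what matches the normalization of the averages in
the definition of a Lebesgue point. *)
Lemma mollifier_bounded : exists C : R, 0 < C /\
  forall a e x : R, 0 < e -> `|mollifier a e x| <= C / e.
Proof.
have [||C [C0 Cb]] := @bounded_compact_support R (derive1 smooth_step) 1.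
- exact/smooth_continuous/smooth_derive1/smooth_smooth_step.
- move=> x x1; apply: derive_step_outside; apply: contraTN x1 => /andP[x0 x1].
  by rewrite -leNgt ger0_norm.
exists C; split => // a e x e0.
by rewrite /mollifier normrM normfV (gtr0_norm e0) ler_wpM2r// invr_ge0 ltW.
Qed.

Lemma Rintegral_mollifier (a e : R) : 0 < e ->
  \int[mu]_x mollifier a e x = 1.
Proof.
move=> e0; rewrite (@Rintegral_support _ _ `[a - e, a + e]); last first.
  move=> x xa; apply: mollifier_outside => //; apply: contra_notN xa.
  by move=> /andP[ax xa]; rewrite /= in_itv/= xa andbT; lra.
rewrite (@Rintegral_derive _ _ _ _ _ _ (is_derive_scaled_step a e)).
- rewrite smooth_step1 ?smooth_step0 ?subr0//.
    by rewrite addrAC subrr add0r mulNr divff ?gt_eqF// lerN10.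
  by rewrite addrAC subrr add0r divff ?gt_eqF.
- lra.
- exact: continuous_mollifier.
Qed.

Lemma integrable_mul_mollifier f (a e : R) : 0 < e -> locally_integrable setT f ->
  mu.-integrable setT (EFin \o (fun x => f x * mollifier a e x)).
Proof.
move=> e0 lf; apply: (@integrable_mul_support _ _ _ (`|a| + e)) => //.
  exact: continuous_mollifier.
move=> x xa; apply: mollifier_outside => //; apply: contraTN xa => /andP[ax xa].
rewrite -leNgt ler_norml; apply/andP; split.
  by have := ler_norm (- a); rewrite normrN; lra.
by rewrite (le_trans xa)// lerD2r ler_norm.
Qed.

(** Since the mollifier has mass [1], the error is
[|\int (f x - f a) k x| <= C/e \int_B |f x - f a|] over the ball [B] of radius
[2 e] about [a], that is [4 C] times the mean oscillation that tends to [0] at a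
Lebesgue point. *)
Lemma cvg_mollifier f (a : R) : locally_integrable setT f -> lebesgue_pt f a ->
  \int[mu]_x (f x * mollifier a e x) @[e --> 0^'+] --> f a.
Proof.
move=> lf la; have [C [C0 Cb]] := mollifier_bounded.
apply/cvgrPdist_le => eta eta0.
have eC0 : 0 < eta / (4 * C) by rewrite divr_gt0// mulr_gt0.
have /fine_cvgP[_ /cvgrPdist_le /(_ _ eC0)] := la.
move=> [d /= d0 Hd].
near=> e.
have e0 : 0 < e by near: e; exact: nbhs_right_gt.
have e2 : 0 < e *+ 2 by rewrite mulrn_wgt0.
have ed : e *+ 2 < d.
  rewrite -mulr_natr -ltr_pdivlMr//; near: e; apply: nbhs_right_lt.
  by rewrite divr_gt0.
have := Hd (e *+ 2); rewrite /= sub0r !normrN (gtr0_norm e2) => /(_ ed e2).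
rewrite sub0r normrN.
set B := ball a (e *+ 2).
have mB : measurable B by exact: measurable_ball.
have intc (k : R) : mu.-integrable B (EFin \o (fun x => f x - k)).
  apply: (@integrableS _ _ _ mu `[a - e *+ 2, a + e *+ 2]) => //.
    by rewrite /B ball_itv; exact: subset_itvW.
  apply: locally_integrable_compact; last exact: segment_compact.
  apply: (@locally_integrableB _ _ f (fun=> k)) => //.
  by apply: continuous_locally_integrable => x; exact: cvg_cst.
have -> : fine (davg f a (e *+ 2)) = (\int[mu]_(x in B) `|f x - f a|) / (e *+ 4).
  rewrite /davg /iavg -/B.
  have -> : mu B = (e *+ 4)%:E.
    by rewrite lebesgue_measure_ball ?(ltW e2)// -mulrnA.
  rewrite inver gt_eqF ?mulrn_wgt0// fineM//=.
    by rewrite mulrC; congr (fine _ / _); apply: eq_integral => x _.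
  apply: integrable_fin_num => //.
  exact: (integrable_norm (intc (f a))).
have I0 : 0 <= \int[mu]_(x in B) `|f x - f a| by exact: Rintegral_ge0.
rewrite ger0_norm ?divr_ge0 ?mulrn_wge0 ?(ltW e0)//.
rewrite ler_pdivrMr ?mulrn_wgt0// => Hle.
have -> : f a = \int[mu]_x (f a * mollifier a e x).
  rewrite RintegralZl ?Rintegral_mollifier ?mulr1//.
  have := @integrable_mul_mollifier (fun=> 1) a e e0.
  rewrite (_ : (fun x => 1 * _) = mollifier a e) => [H|].
    by apply: H; apply: continuous_locally_integrable => x; exact: cvg_cst.
  by apply/funext => x; rewrite mul1r.
rewrite distrC -RintegralB//; last 2 first.
  exact: integrable_mul_mollifier.
  apply: (@integrable_mul_mollifier (fun=> f a)) => //.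
  by apply: continuous_locally_integrable => x; exact: cvg_cst.
rewrite (@Rintegral_support _ _ B); last first.
  by move=> x xB; rewrite mollifier_ball// !mulr0 subrr.
rewrite (_ : (fun x => _) = (fun x => (f x - f a) * mollifier a e x)); last first.
  by apply/funext => x; rewrite mulrBl.
have iB : mu.-integrable B (EFin \o (fun x => (f x - f a) * mollifier a e x)).
  apply: (@integrable_mul_bounded _ _ _ _ (C / e)) => //.
  - by move=> x; exact: Cb.
  - by apply: measurable_funB; [case: lf|exact: measurable_cst].
  - exact: continuous_mollifier.
rewrite (le_trans (le_normr_Rintegral _ iB))//.
apply: (@le_trans _ _ (\int[mu]_(x in B) (C / e * `|f x - f a|))).
  apply: le_Rintegral => //.
  - exact: (integrable_norm iB).
  - exact: (@integrableZl _ _ _ mu _ mB (C / e)) (integrable_norm (intc (f a))).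
  - by move=> x _; rewrite normrM mulrC ler_wpM2r// Cb.
rewrite RintegralZl//; last exact: (integrable_norm (intc (f a))).
rewrite mulrAC ler_pdivrMr// mulrC -ler_pdivlMr//.
rewrite (le_trans Hle)// invfM mulrC mulrnAl mulrA -mulr_natr.
rewrite le_eqVlt; apply/orP; left; apply/eqP; field.
by rewrite gt_eqF.
Unshelve. all: by end_near. Qed.

End mollification.

(** * The lemma of du Bois-Reymond *)

Section du_bois_reymond.
Context {R : realType}.
Local Notation mu := (@lebesgue_measure R).
Implicit Types f g h psi : R -> R.

(** For [a < b], a smooth version of the indicator of [[a, b]]; its derivative is the difference
of the mollifiers at [a] and [b]. *)
Definition window (a b e x : R) : R :=
  smooth_step ((x - a) / e) - smooth_step ((x - b) / e).

Lemma is_derive_window (a b e x : R) :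
  is_derive x 1 (window a b e) (mollifier a e x - mollifier b e x).
Proof.
exact: is_deriveB (is_derive_scaled_step a e x) (is_derive_scaled_step b e x).
Qed.

Lemma bump_window (a b e : R) : 0 < e -> bump_function (window a b e).
Proof.
move=> e0; split.
  rewrite (_ : window a b e = (fun x => smooth_step ((x - a) / e) +
      -1 * smooth_step ((x - b) / e))).
    move=> n; apply: smooth_uptoD; first exact: smooth_scaled_step.
    by apply: smooth_uptoM; [exact: smooth_upto_cst|exact: smooth_scaled_step].
  by apply/funext => x; rewrite mulN1r.
exists (`|a| + `|b| + e); split; first by rewrite ltr_wpDl// addr_ge0.
move=> x; rewrite ltNge ler_norml negb_and -!ltNge.
have Ha := ler_norm a; have Hb := ler_norm b.
have Na := ler_norm (- a); have Nb := ler_norm (- b); rewrite !normrN in Na Nb.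
have pa := normr_ge0 a; have pb := normr_ge0 b.
case/orP => xab; rewrite /window.
  by rewrite !smooth_step0 ?subrr// ler_pdivrMr// mul0r; lra.
by rewrite !smooth_step1 ?subrr// ler_pdivlMr// mul1r; lra.
Qed.

(** Testing with [window a b e] and letting [e] tend to [0] shows that [f - G], for
any primitive [G] of [h], takes the same value at all Lebesgue points of [f]. *)
Lemma du_bois_reymond f h : locally_integrable setT f -> continuous h ->
  (forall psi, bump_function psi ->
    \int[mu]_x (f x * derive1 psi x) = - \int[mu]_x (h x * psi x)) ->
  exists H : R -> R, (forall x : R, is_derive x 1 H (h x)) /\
    forall x, lebesgue_pt f x -> f x = H x.
Proof.
move=> lf ch fh; have [G dG] := continuous_antiderivative ch.
have cG := is_derive_continuous dG.
have lG := continuous_locally_integrable cG.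
have eqG a b : lebesgue_pt f a -> lebesgue_pt f b -> f a - f b = G a - G b.
  move=> fa fb.
  have Gpt x : lebesgue_pt G x.
    apply: (@continuous_lebesgue_pt _ G x setT).
    - by split => //; exact: openT.
    - exact: measurableT.
    - exact: continuous_measurable_fun.
    - exact: cG.
  have winE g e : 0 < e -> locally_integrable setT g ->
      \int[mu]_x (g x * derive1 (window a b e) x) =
      \int[mu]_x (g x * mollifier a e x) - \int[mu]_x (g x * mollifier b e x).
    move=> e0 lg; rewrite -RintegralB//; try exact: integrable_mul_mollifier.
    apply: eq_Rintegral => x _; rewrite -mulrBr; congr (_ * _).
    exact: (derive1_is (is_derive_window a b e)).
  have Lf : \int[mu]_x (f x * derive1 (window a b e) x) @[e --> 0^'+] --> f a - f b.
    apply: cvg_trans (cvgB (cvg_mollifier lf fa) (cvg_mollifier lf fb)).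
    by apply: near_eq_cvg; near=> e; apply/esym/winE.
  have LG : \int[mu]_x (f x * derive1 (window a b e) x) @[e --> 0^'+] --> G a - G b.
    apply: cvg_trans (cvgB (cvg_mollifier lG (Gpt a)) (cvg_mollifier lG (Gpt b))).
    apply: near_eq_cvg; near=> e; have e0 : 0 < e by [].
    have bw := bump_window a b e0.
    by rewrite fh// -(Rintegral_by_parts_bump dG ch bw) winE.
  by rewrite -(cvg_lim (@Rhausdorff R) Lf) (cvg_lim (@Rhausdorff R) LG).
have [[x0 fx0]|nof] := pselect (exists x0, lebesgue_pt f x0); last first.
  by exists G; split => // x fx; exfalso; apply: nof; exists x.
exists (fun x => G x + (f x0 - G x0)); split.
  move=> x; have := is_deriveD (dG x) (@is_derive_cst _ _ _ (f x0 - G x0) x 1).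
  by rewrite addr0.
by move=> x fx; have := eqG _ _ fx fx0; lra.
Unshelve. all: by end_near. Qed.

End du_bois_reymond.

(** * The signed power and integrability of the flux *)

Section signed_power.
Context {R : realType}.
Implicit Types q x y : R.

(** For [q = 1/(p-1)], the inverse of [w |-> |w|^(p-2) w]. *)
Definition signed_powR q y : R := Num.sg y * `|y| `^ q.

Lemma continuous_powR_gt0 q x : 0 < x -> {for x, continuous (@powR R ^~ q)}.
Proof.
move=> x0; apply: differentiable_continuous; apply/derivable1_diffP.
exact: (@ex_derive _ _ _ _ _ _ _ (is_derive1_powR q x0)).
Qed.

Lemma continuous_norm_powR q : 0 < q -> continuous (fun x : R => `|x| `^ q).
Proof.
move=> q0 x; have [->|x0] := eqVneq x 0.
  apply/cvgrPdist_lt => e e0.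
  near=> y; rewrite normr0 powR0 ?gt_eqF// sub0r normrN ger0_norm ?powR_ge0//.
  rewrite -[e](powRr1 (ltW e0)) -(@mulVf _ q) ?gt_eqF// powRrM.
  apply: gt0_ltr_powR; rewrite ?nnegrE ?powR_ge0//.
  near: y; apply: cvgr0_norm_lt; [exact: cvg_id|exact: powR_gt0].
have : (`|y| @[y --> x] --> `|x|) by apply: cvg_norm; exact: cvg_id.
move=> cn; apply: (@continuous_comp _ _ _ (fun y : R => `|y|) (@powR R ^~ q) x cn).
by apply: continuous_powR_gt0; rewrite normr_gt0.
Unshelve. all: by end_near. Qed.

Lemma continuous_signed_powR q : 0 < q -> continuous (signed_powR q).
Proof.
move=> q0 x; have cn := @continuous_norm_powR q q0 x; rewrite /continuous_at.
have [x0|x0|x0] := ltgtP x 0.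
- have -> : signed_powR q x = - `|x| `^ q by rewrite /signed_powR ltr0_sg// mulN1r.
  apply: cvg_trans (cvgN cn); apply: near_eq_cvg; near=> y.
  rewrite /signed_powR ltr0_sg ?mulN1r//; near: y; exact: lt_nbhsl.
- have -> : signed_powR q x = `|x| `^ q by rewrite /signed_powR gtr0_sg// mul1r.
  apply: cvg_trans cn; apply: near_eq_cvg; near=> y.
  rewrite /signed_powR gtr0_sg ?mul1r//; near: y; exact: lt_nbhsr.
- move: cn; rewrite x0 => cn.
  have -> : signed_powR q 0 = 0 by rewrite /signed_powR sgr0 mul0r.
  apply/cvgrPdist_le => e e0.
  move/cvgrPdist_le : cn => /(_ e e0); apply: filterS => y.
  rewrite normr0 powR0 ?gt_eqF// !sub0r !normrN ger0_norm ?powR_ge0//.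
  apply: le_trans; rewrite /signed_powR normrM normr_sg.
  by case: eqVneq => _; rewrite ?mul0r ?powR_ge0// mul1r ger0_norm ?powR_ge0.
Unshelve. all: by end_near. Qed.

Lemma signed_powR_gt0 q y : 0 < y -> signed_powR q y = y `^ q.
Proof. by move=> y0; rewrite /signed_powR gtr0_sg// mul1r gtr0_norm. Qed.

Lemma signed_powR0 q : signed_powR q 0 = 0.
Proof. by rewrite /signed_powR sgr0 mul0r. Qed.

Lemma signed_powR_eq0 q y : signed_powR q y = 0 -> y = 0.
Proof.
move=> /eqP; rewrite /signed_powR mulf_eq0 sgr_eq0 powR_eq0 normr_eq0.
by case/orP => [/eqP//|/andP[/eqP]].
Qed.

(** The case [y = 0] is separate because [0 `^ 0 = 1] when [p = 1]. *)
Lemma norm_powR_mul p y : `| `|y| `^ (p - 2) * y | = if y == 0 then 0 else `|y| `^ (p - 1).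
Proof.
case: eqVneq => [->|y0]; first by rewrite mulr0 normr0.
rewrite normrM (ger0_norm (powR_ge0 _ _)) -{2}[`|y|]powRr1// -powRD.
  by congr (_ `^ _); ring.
by rewrite normr_eq0 y0 implybT.
Qed.

Lemma signed_powRK p y : 1 < p ->
  signed_powR (p - 1)^-1 (`|y| `^ (p - 2) * y) = y.
Proof.
move=> p1; rewrite /signed_powR norm_powR_mul sgrM.
case: eqVneq => [->|y0]; first by rewrite sgr0 mulr0 mul0r.
rewrite gtr0_sg ?powR_gt0 ?normr_gt0// mul1r -powRrM divff ?powRr1//.
  by rewrite -numEsg.
by rewrite gt_eqF// subr_gt0.
Qed.

Lemma norm_powR_mul_le p y : 1 < p -> `| `|y| `^ (p - 2) * y | <= 1 + `|y| `^ p.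
Proof.
move=> p1; rewrite norm_powR_mul; case: eqVneq => [_|y0].
  by rewrite addr_ge0// powR_ge0.
have [y1|y1] := leP `|y| 1.
  apply: (@le_trans _ _ 1); last by rewrite lerDl powR_ge0.
  apply: (@le_trans _ _ (1 `^ (p - 1))); last by rewrite powR1.
  apply: ge0_ler_powR; rewrite ?nnegrE//.
  by rewrite subr_ge0 ltW.
apply: (@le_trans _ _ (`|y| `^ p)); last by rewrite lerDr.
by apply: ler_powR; [exact: ltW|rewrite gerBl].
Qed.

End signed_power.

Section integrability.
Context {R : realType}.
Local Notation mu := (@lebesgue_measure R).

Lemma locally_Lp_measurable (p : R) (w : R -> R) : locally_Lp p w ->
  measurable_fun setT w.
Proof.
move=> lw; rewrite (_ : setT = \bigcup_(n : nat) `[- n%:R, n%:R]%classic).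
  apply/measurable_fun_bigcup => [n|n]; first exact: measurable_itv.
  apply/(measurable_restrictT _ _).2; first exact: measurable_itv.
  have /lw := @segment_compact R (- n%:R) n%:R.
  by rewrite inE => /andP[/[!inE]].
apply/seteqP; split => // x _.
have [n xn] : exists n : nat, `|x| <= n%:R.
  by exists (Num.trunc `|x|).+1; rewrite ltW// truncnS_gt.
by exists n => //=; rewrite in_itv/= -ler_norml.
Qed.

(** On compact sets the flux is dominated by the integrable [1 + |w|^p]. *)
Lemma locally_Lp_flux (p : R) (w : R -> R) : 1 < p -> locally_Lp p w ->
  locally_integrable setT (fun t => `|w t| `^ (p - 2) * w t).
Proof.
move=> p1 lw; have mw := locally_Lp_measurable lw.
have mF : measurable_fun setT (fun t => `|w t| `^ (p - 2) * w t).
  apply: measurable_funM => //.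
  apply: (measurableT_comp (measurable_powR _)); exact: measurableT_comp.
split => //; first exact: openT.
move=> A _ cA; have mA : measurable A by exact: compact_measurable.
suff : mu.-integrable A (EFin \o (fun t => `|w t| `^ (p - 2) * w t)).
  by case/integrableP.
apply: (@le_integrable _ _ _ mu A mA _ (fun t => (1 + `|w t| `^ p)%:E)).
- by apply/measurable_EFinP; exact: measurable_funS mF.
- move=> t _; rewrite /= lee_fin (ger0_norm (addr_ge0 _ _)) ?powR_ge0//.
  exact: norm_powR_mul_le.
- have i1 : mu.-integrable A (EFin \o (fun=> 1)).
    apply: (@locally_integrable_compact _ (fun=> 1)) => //.
    by apply: continuous_locally_integrable => x; exact: cvg_cst.
  have /Lfun_integrable := lw A cA; rewrite (ltW p1) => /(_ isT) ip.
  apply: (@eq_integrable _ _ _ mu A mA ((EFin \o (fun=> 1)) \+ (fun t => (`|w t| `^ p)%:E))) => //.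
  apply: integrableD => //.
  apply: (@eq_integrable _ _ _ mu A mA (fun t => (`|(w \_ A) t| `^ p)%:E)).
    by move=> t tA; rewrite patchE tA.
  exact: integrableS ip.
Qed.

Lemma unif_continuous_continuous (f : R -> R) : unif_continuous f -> continuous f.
Proof.
move=> uf x; apply/cvg_entourageP => A /uf.
by move=> /(nbhs_entourage x); apply: filterS => y /xsectionP.
Qed.


End integrability.

(** * Integrating the wave equation *)

Section wave.
Context {R : realType}.
Local Notation mu := (@lebesgue_measure R).
Implicit Types (f phi b d : R -> R) (m p r c K : R).

(** A convergent difference quotient is bounded near [x]. *)
Lemma derivable_in_lipschitz (A : set R) f (x : R) : derivable_in A f x ->
  exists L : R, 0 < L /\
    \forall y \near x, A y -> `|f y - f x| <= L * `|y - x|.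
Proof.
move=> /cvg_ex[/= l /cvgrPdist_lt /(_ 1 ltr01) Hl].
exists (`|l| + 1); split; first by rewrite ltr_wpDl.
rewrite /= in Hl; near=> y => Ay.
have [->|yx] := eqVneq y x; first by rewrite !subrr normr0 mulr0.
have : `|l - (f y - f x) / (y - x)| < 1 by move: yx Ay; near: y; exact: Hl.
move=> H; rewrite -ler_pdivrMr ?normr_gt0 ?subr_eq0// -normfV -normrM.
have := ler_normB l (l - (f y - f x) / (y - x)).
rewrite opprB addrCA subrr addr0. lra.
Unshelve. all: by end_near. Qed.

Lemma continuous_comp_derivable_in (A : set R) f phi :
  (forall x, A x -> derivable_in A f x) -> (forall t, A (phi t)) ->
  continuous phi -> continuous (f \o phi).
Proof.
move=> df Aphi cphi t.
have [L [L0 HL]] := derivable_in_lipschitz (df _ (Aphi t)).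
apply/cvgrPdist_lt => e e0.
have eL : 0 < e / L by rewrite divr_gt0.
have cp := cphi t.
near=> s; rewrite distrC /=.
apply: (@le_lt_trans _ _ (L * `|phi s - phi t|)).
  by apply: (_ : A (phi s) -> _) (Aphi s); near: s; exact: (cp _ HL).
rewrite mulrC -ltr_pdivlMr// distrC; near: s.
by move/cvgrPdist_lt : cp; exact.
Unshelve. all: by end_near. Qed.

Lemma eq_ae_Rintegral f g : measurable_fun setT f -> measurable_fun setT g ->
  {ae mu, forall x, f x = g x} -> \int[mu]_x f x = \int[mu]_x g x.
Proof.
move=> mf mg fg; congr fine; apply: ae_eq_integral => //.
- exact/measurable_EFinP.
- exact/measurable_EFinP.
- by apply: (@filterS _ _ (ae_filter_ringOfSetsType mu) _ _ _ fg) => x /= -> _.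
Qed.

(** Du Bois-Reymond is used twice: first on the equation, for the flux minus
[c phi], then on the definition of the weak derivative, for [phi ^ m].  The
second primitive agrees with [phi ^ m] everywhere since every point is a Lebesgue
point of a continuous function. *)
Lemma wave_regularity m p r K c b d phi : 0 < m -> 1 < p ->
  (forall s, 0 <= s <= K -> derivable_in `[0, K] d s) ->
  (forall s, 0 <= s <= K -> derivable_in `[0, K] b s) ->
  traveling_wave m p r K b d c phi ->
  exists H : R -> R,
    (forall x : R, is_derive x 1 H (d (phi x) - b (phi (x - c * r)))) /\
    (forall x : R, is_derive x 1 (fun t => phi t `^ m)
       (signed_powR (p - 1)^-1 (c * phi x + H x))).
Proof.
move=> m0 p1 dd db [_ /unif_continuous_continuous cphi rphi _ _].
move=> [w [[_ lw wd] tw]].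
have Aphi t : `[0, K]%classic (phi t) by rewrite /= in_itv/= rphi.
have cd : continuous (d \o phi).
  by apply: (@continuous_comp_derivable_in `[0, K]) => //.
have cshift : continuous (fun t => phi (t - c * r)).
  move=> t; apply: (@continuous_comp _ _ _ (fun t : R => t - c * r) phi).
    by apply: cvgB; [exact: cvg_id|exact: cvg_cst].
  exact: cphi.
have cb : continuous (b \o (fun t => phi (t - c * r))).
  exact: (@continuous_comp_derivable_in `[0, K]).
pose F t := `|w t| `^ (p - 2) * w t.
have lF : locally_integrable setT F by exact: locally_Lp_flux.
pose g t := d (phi t) - b (phi (t - c * r)).
have cg : continuous g by move=> t; apply: cvgB; [exact: cd|exact: cb].
pose cphi' t := c * phi t.
have ccphi : continuous cphi'.
  by move=> t; apply: cvgM; [exact: cvg_cst|exact: cphi].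
have lcphi := continuous_locally_integrable ccphi.
have lphi := continuous_locally_integrable cphi.
have int_bump f psi : locally_integrable setT f -> bump_function psi ->
    mu.-integrable setT (EFin \o (fun x => f x * derive1 psi x)).
  move=> lf [sp [N [N0 pN]]]; apply: (@integrable_mul_support _ _ _ N) => //.
    exact/smooth_continuous/smooth_derive1.
  by move=> x; exact: derive1_outside.
(* The equation with the terms gathered into the form that du_bois_reymond asks
   for: the reaction terms are - g. *)
have eq1 psi : bump_function psi ->
    \int[mu]_x ((F \- cphi') x * derive1 psi x) = - \int[mu]_x (g x * psi x).
  move=> bp; have := tw psi (bump_test_function bp).
  rewrite -RintegralZl ?int_bump//.
  under [X in _ = _ + X]eq_Rintegral do rewrite -opprB mulNr.
  rewrite [X in _ = _ + X](_ : _ = - \int[mu]_x (g x * psi x)); last first.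
    rewrite -[RHS]mulN1r -RintegralZl//.
      by apply: eq_Rintegral => x _; rewrite mulN1r.
    case: bp => [sp [N [N0 pN]]]; apply: (@integrable_mul_support _ _ _ N) => //.
      exact: continuous_locally_integrable.
    exact: smooth_continuous.
  under eq_Rintegral do rewrite mulrA -/(cphi' _).
  under [X in _ = - X + _]eq_Rintegral do rewrite -/(F _).
  under [X in _ -> X = _]eq_Rintegral do rewrite /= mulrBl.
  by rewrite RintegralB ?int_bump//; lra.
have lFc := locally_integrableB lF lcphi.
have [H [dH FH]] := du_bois_reymond lFc cg eq1.
exists H; split => //.
pose W t := signed_powR (p - 1)^-1 (c * phi t + H t).
have cW : continuous W.
  move=> t; apply: (@continuous_comp _ _ _ (fun t => c * phi t + H t)).
    by apply: cvgD; [exact: ccphi|exact: (is_derive_continuous dH)].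
  by apply: continuous_signed_powR; rewrite invr_gt0 subr_gt0.
have wW : {ae mu, forall t, w t = W t}.
  have := lebesgue_differentiation lFc.
  apply: (@filterS _ _ (ae_filter_ringOfSetsType mu)) => t /FH /= Ft.
  rewrite /W -(@signed_powRK _ p (w t) p1); congr signed_powR.
  by rewrite -/(F t) -Ft /cphi' addrC subrK.
have cv : continuous (fun t => phi t `^ m).
  rewrite (_ : (fun _ => _) = (fun t => `|phi t| `^ m)).
    move=> t; apply: (@continuous_comp _ _ _ phi (fun y : R => `|y| `^ m)); first exact: cphi.
    exact: continuous_norm_powR.
  by apply/funext => t; rewrite ger0_norm//; case/andP: (rphi t).
have mw := locally_Lp_measurable lw.
have [V [dV vV]] : exists V : R -> R, (forall x : R, is_derive x 1 V (W x)) /\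
    forall x, lebesgue_pt (fun t => phi t `^ m) x -> phi x `^ m = V x.
  apply: (@du_bois_reymond _ (fun t => phi t `^ m) W) => //.
    exact: continuous_locally_integrable.
  move=> psi bp; rewrite (wd _ (bump_test_function bp)); congr (- _).
  have mp := continuous_measurable_fun (smooth_continuous bp.1).
  apply: eq_ae_Rintegral.
  - exact: measurable_funM.
  - by apply: measurable_funM => //; exact: continuous_measurable_fun.
  - by apply: (@filterS _ _ (ae_filter_ringOfSetsType mu) _ _ _ wW) => t ->.
have -> : (fun t => phi t `^ m) = V.
  apply/funext => t; apply: vV; apply: (@continuous_lebesgue_pt _ _ t setT).
  - by split => //; exact: openT.
  - exact: measurableT.
  - exact: continuous_measurable_fun.
  - exact: cv.
exact: dV.
Qed.

End wave.

(** * The flux near the front *)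

Section front.
Context {R : realType}.
Implicit Types (f phi b d H : R -> R) (m p r c K : R).

Lemma continuous_eq0_left f (t0 : R) : {for t0, continuous f} ->
  (forall t, t < t0 -> f t = 0) -> f t0 = 0.
Proof.
move=> cf f0; have cl : f t @[t --> t0^'-] --> f t0 by exact: cvg_at_left_filter.
rewrite -(cvg_lim (@Rhausdorff R) cl); apply: cvg_lim => //.
apply: (@cvg_trans _ ((0 : R) @[t --> t0^'-])); last exact: cvg_cst.
apply: near_eq_cvg; near=> t; apply/esym/f0; near: t; exact: nbhs_left_lt.
Unshelve. all: by end_near. Qed.

Lemma fun_support_eq0 phi (t0 t : R) : fun_support phi = `[t0, +oo[%classic ->
  t < t0 -> phi t = 0.
Proof.
move=> supp tt0; apply/eqP; apply: contraTT tt0 => phit.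
have : fun_support phi t by exact: subset_closure.
by rewrite supp /= in_itv/= andbT -leNgt.
Qed.

(** On the left of the front [phi ^ m] is locally constant, so that its derivative
[S (c 0 + H)] vanishes, and [S] has no other zero than [0]. *)
Lemma flux_constant_eq0 m q c phi H (t0 : R) : m != 0 ->
  (forall t, t < t0 -> phi t = 0) -> continuous H ->
  (forall x : R, is_derive x 1 (fun t => phi t `^ m) (signed_powR q (c * phi x + H x))) ->
  forall t, t <= t0 -> H t = 0.
Proof.
move=> m0 phi0 cH dv.
have Hlt t : t < t0 -> H t = 0.
  move=> tt0; have := derive1_is dv t; rewrite (@derive1_near_cst _ _ _ 0).
    by move/esym/signed_powR_eq0; rewrite phi0// mulr0 add0r.
  near=> y; rewrite phi0 ?powR0//; near: y; exact: lt_nbhsl.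
move=> t; rewrite le_eqVlt => /predU1P[->|]; last exact: Hlt.
by apply: continuous_eq0_left => //; exact: cH.
Unshelve. all: by end_near. Qed.

Lemma derivable_in_linear_bound K f : 0 <= K -> derivable_in `[0, K] f 0 -> f 0 = 0 ->
  exists L e : R, [/\ 0 < L, 0 < e &
    forall s, 0 <= s <= K -> s < e -> `|f s| <= L * s].
Proof.
move=> K0 df f0; have [L [L0 /nbhs_ballP[e /= e0 He]]] := derivable_in_lipschitz df.
exists L, e; split => // s sK se.
have /He : ball 0 e s by rewrite /ball /= sub0r normrN ger0_norm//; case/andP: sK.
rewrite f0 !subr0 (ger0_norm (proj1 (andP sK))); apply.
by rewrite /= in_itv.
Qed.

(** The constant [e] is chosen so that [L e <= c / 2], where [L] is the sum of the
linear bounds of [d] and [b] near [0].  The delayed value [phi (x - c r)] belongs to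
the past of [x], so the maximum [phi s] bounds it as well as [phi x]. *)
Lemma flux_estimate m q r K b d c phi H (t0 : R) :
  0 < m -> 0 <= r -> 0 < c ->
  derivable_in `[0, K] d 0 -> derivable_in `[0, K] b 0 -> d 0 = 0 -> b 0 = 0 ->
  continuous phi -> (forall t, 0 <= phi t <= K) ->
  (forall t, t <= t0 -> phi t = 0) -> (forall t, t0 < t -> 0 < phi t) ->
  H t0 = 0 ->
  (forall x : R, is_derive x 1 H (d (phi x) - b (phi (x - c * r)))) ->
  (forall x : R, is_derive x 1 (fun t => phi t `^ m) (signed_powR q (c * phi x + H x))) ->
  exists e : R, 0 < e /\ forall t, t0 < t < t0 + e ->
    `|H t| <= c / 2 * phi t /\ phi t <= 1.
Proof.
move=> m0 r0 c0 dd db d0 b0 cphi rphi phi0 phi1 H0 dH dv.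
have K0 : 0 <= K by have /andP[a1 a2] := rphi 0; exact: le_trans a2.
have [Ld [ed [Ld0 ed0 Hd]]] := derivable_in_linear_bound K0 dd d0.
have [Lb [eb [Lb0 eb0 Hb]]] := derivable_in_linear_bound K0 db b0.
have phit0 : phi t0 = 0 by exact: phi0.
pose e1 := Num.min 1 (Num.min ed eb).
have e10 : 0 < e1 by rewrite !lt_min ltr01 ed0.
have /cvgrPdist_lt/(_ _ e10)/nbhs_ballP[e2 /= e20 He2] := cphi t0.
have small t : t < t0 + e2 -> phi t < e1.
  move=> te; have [tt0|tt0] := leP t t0; first by rewrite phi0.
  have /He2 : ball t0 e2 t.
    by rewrite /ball /= ltr_norml; apply/andP; split; lra.
  by rewrite /= phit0 sub0r normrN ger0_norm//; case/andP: (rphi t).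
pose L := Ld + Lb; have L0 : 0 < L by rewrite addr_gt0.
have cL0 : 0 < c / (2 * L) by rewrite divr_gt0// mulr_gt0.
exists (Num.min e2 (c / (2 * L))); split; first by rewrite lt_min e20.
move=> t /andP[t0t]; rewrite -ltrBlDl lt_min => /andP[te2 teL].
have tsmall := small t; split; last first.
  by apply/ltW; apply: (lt_le_trans (tsmall _)); [lra|rewrite ge_min lexx].
(* It suffices to prove the estimate at the maximum point s, and that s = t. *)
have [s sI smax] := EVT_max (ltW t0t) (continuous_subspaceT cphi).
have /andP[t0s st] : t0 <= s <= t by move: sI; rewrite in_itv.
have phis : 0 < phi s by apply: lt_le_trans (smax t _); rewrite ?phi1// in_itv/= lexx ltW.
have {}t0s : t0 < s.
  by rewrite lt_neqAle t0s andbT; apply: contraTneq phis => <-; rewrite phit0 ltxx.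
have past x : x <= t -> phi x <= phi s.
  move=> xt; have [xt0|xt0] := leP x t0; first by rewrite phi0// ltW.
  by apply: smax; rewrite in_itv/= xt ltW.
have Hs : `|H s| <= c / 2 * phi s.
  have [x xI HE] := MVT t0s (fun x _ => dH x)
    (continuous_subspaceT (is_derive_continuous dH)).
  move: xI; rewrite in_itv/= => /andP[t0x xs].
  rewrite H0 subr0 in HE; rewrite HE.
  have gx : `|d (phi x) - b (phi (x - c * r))| <= L * phi s.
    have cr0 : 0 <= c * r by rewrite mulr_ge0// ltW.
    apply: (le_trans (ler_normB _ _)); rewrite mulrDl; apply: lerD.
      apply: (le_trans (Hd _ (rphi _) _)).
        by apply: (lt_le_trans (small x _)); [lra|rewrite !ge_min lexx orbT].
      by rewrite ler_wpM2l// ?(ltW Ld0)// past//; lra.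
    apply: (le_trans (Hb _ (rphi _) _)).
      by apply: (lt_le_trans (small _ _)); [lra|rewrite !ge_min lexx !orbT].
    by rewrite ler_wpM2l// ?(ltW Lb0)// past//; lra.
  rewrite normrM (gtr0_norm (_ : 0 < s - t0)) ?subr_gt0//.
  apply: (@le_trans _ _ (L * phi s * (c / (2 * L)))).
    by apply: ler_pM => //; [rewrite subr_ge0 ltW|lra].
  rewrite le_eqVlt; apply/orP; left; apply/eqP; field.
  by rewrite gt_eqF.
suff -> : t = s by [].
apply/eqP; apply: contraTT isT => ts.
(* Otherwise v = phi ^ m has an interior maximum at s, where c phi + H > 0. *)
have {ts}st' : s < t by rewrite lt_neqAle st eq_sym ts.
have dvs : is_derive s 1 (fun t => phi t `^ m) 0.
  apply: (@derive1_at_max _ _ t0 t s (ltW t0t)).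
  - by move=> x _; exact: ex_derive.
  - by rewrite in_itv/= t0s.
  - move=> x; rewrite in_itv/= => /andP[_ xt].
    have p0 y : 0 <= phi y by case/andP: (rphi y).
    by apply: ge0_ler_powR; rewrite ?nnegrE ?(ltW m0)// past// ltW.
have := derive1_is dv s; rewrite derive1E (@derive_val _ _ _ _ _ _ _ dvs).
move/esym/signed_powR_eq0 => E0.
have : 0 < c * phi s by rewrite mulr_gt0.
by move: Hs; rewrite (_ : H s = - (c * phi s)) ?normrN; [|lra] => + P; rewrite gtr0_norm//; lra.
Qed.

(** Where [phi > 0], the derivative of [phi = (phi ^ m) ^ (1/m)] by the chain rule. *)
Definition wave_slope m q c phi H (t : R) : R :=
  m^-1 * phi t `^ (1 - m) * signed_powR q (c * phi t + H t).

Lemma is_derive_wave m q c phi H (t : R) : 0 < m ->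
  continuous phi -> (forall t, 0 <= phi t) -> 0 < phi t ->
  (forall x : R, is_derive x 1 (fun t => phi t `^ m) (signed_powR q (c * phi x + H x))) ->
  is_derive t 1 phi (wave_slope m q c phi H t).
Proof.
move=> m0 cphi phi0 phit dv.
have vt : 0 < phi t `^ m by exact: powR_gt0.
have := @is_derive1_comp _ (@powR R ^~ m^-1) (fun t => phi t `^ m) t _ _
  (is_derive1_powR _ vt) (dv t).
rewrite (_ : _ \o _ = phi); last first.
  by apply/funext => x; rewrite /= -powRrM divff ?gt_eqF// powRr1.
move/is_derive_eq; apply; rewrite /wave_slope; congr (_ * _ * _).
by rewrite -powRrM mulrBr mulr1 divff ?gt_eqF.
Qed.

(** The factor [c phi + H] lies between [c/2 phi] and [2 c phi], so the slope is
comparable with [phi ^ (1 - m) phi ^ q]. *)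
Lemma wave_slope_bounds m q c phi H (t : R) : 0 < m -> 0 < c -> 0 < q -> 0 < phi t ->
  `|H t| <= c / 2 * phi t ->
  m^-1 * (c / 2) `^ q * phi t `^ (1 + q - m) <= wave_slope m q c phi H t <=
  m^-1 * (2 * c) `^ q * phi t `^ (1 + q - m).
Proof.
move=> m0 c0 q0 phi0; rewrite ler_norml => /andP[Hl Hu].
have cphi : 0 < c * phi t by rewrite mulr_gt0.
have S0 : 0 < c * phi t + H t by lra.
have E k : 0 < k -> m^-1 * k `^ q * phi t `^ (1 + q - m) =
    m^-1 * phi t `^ (1 - m) * (k * phi t) `^ q.
  move=> k0; rewrite (_ : 1 + q - m = (1 - m) + q); last by ring.
  rewrite powRD ?(gt_eqF phi0) ?implybT// powRM ?ltW//; ring.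
have c2 : 0 < c / 2 by rewrite divr_gt0.
rewrite /wave_slope signed_powR_gt0// !E ?mulr_gt0//.
have k0 : 0 <= m^-1 * phi t `^ (1 - m) by rewrite mulr_ge0 ?powR_ge0// invr_ge0 ltW.
by apply/andP; split; apply: ler_wpM2l => //; apply: ge0_ler_powR;
  rewrite ?nnegrE; lra.
Qed.

End front.

(** * Smoothness at the front *)

Section smoothness.
Context {R : realType}.
Implicit Types (phi D : R -> R).

(** A continuous derivative would be [0] at [t0] by approach from the left, hence
smaller than [k] slightly to the right. *)
Lemma not_C1_of_slope_gap phi (t0 e k : R) : 0 < e -> 0 < k ->
  (forall t, t < t0 -> phi t = 0) ->
  (forall t, t0 < t < t0 + e -> k <= derive1 phi t) ->
  ~ C1_smooth phi.
Proof.
move=> e0 k0 phi0 slope [_ cphi'].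
have dphi0 t : t < t0 -> derive1 phi t = 0.
  move=> tt0; apply: (@derive1_near_cst _ _ _ 0); near=> y; apply: phi0.
  by near: y; exact: lt_nbhsl.
have z := continuous_eq0_left (cphi' t0) dphi0.
have /cvgrPdist_lt/(_ _ k0)/nbhs_ballP[e1 /= e10 He] := cphi' t0.
pose h := Num.min e e1 / 2.
have h0 : 0 < h by rewrite divr_gt0// lt_min e0.
have he : h < e.
  by rewrite ltr_pdivrMr// (le_lt_trans (_ : _ <= e)) ?ge_min ?lexx//; lra.
have he1 : h < e1.
  by rewrite ltr_pdivrMr// (le_lt_trans (_ : _ <= e1)) ?ge_min ?lexx ?orbT//; lra.
have /slope kh : t0 < t0 + h < t0 + e by rewrite ltrDl h0 ltrD2l.
have /He : ball t0 e1 (t0 + h).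
  by rewrite /ball /= opprD addrA subrr sub0r normrN gtr0_norm.
by rewrite z sub0r normrN ltNge (le_trans kh)// ler_norm.
Unshelve. all: by end_near. Qed.

(** [D] is continuous at [t0] by the power bound; the mean value theorem on
[[t0, x]] then gives the derivative [0] at [t0] itself. *)
Lemma C1_of_slope_vanishing phi D (t0 e C g : R) : 0 < e -> 0 < g -> 0 <= C ->
  continuous phi ->
  (forall t, t <= t0 -> phi t = 0) -> (forall t, t <= t0 -> D t = 0) ->
  (forall t : R, t0 < t -> is_derive t 1 phi (D t)) ->
  (forall t, t0 < t -> {for t, continuous D}) ->
  (forall t, t0 < t < t0 + e -> `|D t| <= C * `|phi t| `^ g) ->
  C1_smooth phi.
Proof.
move=> e0 g0 C0 cphi phi0 D0 dphi cD bD.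
have near0 (k : R) : 0 < k -> \forall t \near t0, `|D t| <= k.
  move=> k0; have phit0 : phi t0 = 0 by exact: phi0.
  have cg : C * `|phi t| `^ g @[t --> t0] --> C * `|phi t0| `^ g.
    apply: cvgM; first exact: cvg_cst.
    apply: (@continuous_comp _ _ _ phi (fun y : R => `|y| `^ g)); first exact: cphi.
    exact: continuous_norm_powR.
  rewrite phit0 normr0 powR0 ?gt_eqF// mulr0 in cg.
  have small : \forall t \near t0, `|C * `|phi t| `^ g| < k.
    by move/cvgrPdist_lt : cg => /(_ _ k0); apply: filterS => t; rewrite sub0r normrN.
  near=> t; have [tt0|t0t] := leP t t0; first by rewrite D0// normr0 ltW.
  rewrite (le_trans (bD t _))//.
    by rewrite t0t/=; near: t; apply: lt_nbhsl; rewrite ltrDl.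
  by rewrite (le_trans (ler_norm _))// ltW//; near: t.
have dall (t : R) : is_derive t 1 phi (D t).
  have [tt0|t0t|->] := ltgtP t t0; last 2 first.
  - exact: dphi.
  - rewrite D0//; apply: is_derive1_eps => k k0.
    have /nbhs_ballP[e1 /= e10 He] := near0 k k0.
    apply/nbhs_ballP; exists e1 => //= x xe.
    rewrite (phi0 t0)// subr0 mul0r subr0.
    have [xt0|t0x] := leP x t0; first by rewrite phi0// normr0 mulr_ge0// ltW.
    have [|s] := @MVT R phi D t0 x t0x _ (continuous_subspaceT cphi).
      by move=> s; rewrite in_itv/= => /andP[t0s _]; exact: dphi.
    rewrite in_itv/= (phi0 t0)// subr0 => /andP[t0s sx] ->.
    rewrite normrM ler_wpM2r//; apply: He.
    move: xe; rewrite /ball /= ltr_distlC ltr_distlC => /andP[_ xe].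
    by apply/andP; split; lra.
  rewrite D0 ?ltW//; apply: (@near_eq_is_derive _ _ _ (cst 0)).
  near=> x; rewrite /= phi0// ltW//; near: x; exact: lt_nbhsl.
split; first by move=> t; exact: ex_derive.
have -> : derive1 phi = D by apply/funext; exact: (derive1_is dall).
move=> t; have [tt0|t0t|->] := ltgtP t t0.
- rewrite /continuous_at D0 ?ltW//.
  apply/cvgrPdist_le => k k0; near=> x.
  rewrite (D0 x) ?subrr ?normr0 ?(ltW k0)// ltW//; near: x; exact: lt_nbhsl.
- exact: cD.
- apply/cvgrPdist_le => k k0; move: (near0 k k0); apply: filterS => x.
  by rewrite (D0 t0)// sub0r normrN.
Unshelve. all: by end_near. Qed.

End smoothness.

Theorem mainTheorem3 (R : realType) (m p r K : R) (b d : R -> R)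
    (c : R) (phi : R -> R)
    (hm : 0 < m) (hp : 1 < p) (hmp : 1 < m * (p - 1)) (hr : 0 <= r)
    (hH1 : conditionH1 K b d) (hH2 : conditionH2 K b d)
    (hc : 0 < c) (hcmin : c = minimal_wave_speed m p r K b d)
    (htw : traveling_wave m p r K b d c phi) (hsharp : sharp_type phi) :
  (p / (p - 1) <= m -> ~ C1_smooth phi) /\
  ((p - 1)^-1 < m < p / (p - 1) -> C1_smooth phi).
Proof.
have [K0 [d0 b0] _ _ _ _] := hH1.
have [[[dd _ _] [db _ _]] _] := hH2.
have in0K s : 0 <= s <= K -> `[0, K]%classic s by rewrite /= in_itv.
have zero0K : `[0, K]%classic 0 by apply: in0K; rewrite lexx ltW.
have [H [dH dv]] := wave_regularity hm hp
  (fun s sK => dd s (in0K s sK)) (fun s sK => db s (in0K s sK)) htw.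
have cphi := unif_continuous_continuous (tw_unif_continuous htw).
have rphi := tw_range htw.
have phi_ge0 t : 0 <= phi t by case/andP: (rphi t).
have [t0 [supp phi_gt0]] := hsharp.
have phi_lt t : t < t0 -> phi t = 0 by exact: fun_support_eq0 supp.
have phi_le t : t <= t0 -> phi t = 0.
  rewrite le_eqVlt => /predU1P[->|]; last exact: phi_lt.
  by apply: continuous_eq0_left => //; exact: cphi.
have cH := is_derive_continuous dH.
have H_le : forall t, t <= t0 -> H t = 0.
  by apply: flux_constant_eq0 cH dv => //; rewrite gt_eqF.
have [e [e0 He]] := flux_estimate hm hr hc (dd _ zero0K) (db _ zero0K) d0 b0
  cphi rphi phi_le phi_gt0 (H_le _ (lexx t0)) dH dv.
set q := (p - 1)^-1 in dv *.
have q0 : 0 < q by rewrite invr_gt0 subr_gt0.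
have pq : p / (p - 1) = 1 + q.
  by rewrite /q; field; rewrite gt_eqF// subr_gt0.
have dphi (t : R) : t0 < t -> is_derive t 1 phi (wave_slope m q c phi H t).
  by move=> t0t; apply: is_derive_wave => //; exact: phi_gt0.
have slope t : t0 < t < t0 + e -> _ :=
  fun tI => wave_slope_bounds hm hc q0 (phi_gt0 t (proj1 (andP tI))) (proj1 (He t tI)).
rewrite pq; split => [mge|/andP[_ mlt]].
  have k0 : 0 < m^-1 * (c / 2) `^ q.
    by rewrite mulr_gt0 ?invr_gt0// powR_gt0// divr_gt0.
  apply: (not_C1_of_slope_gap e0 k0 phi_lt) => t tI.
  have t0t := proj1 (andP tI); have [_ phi1] := He t tI.
  rewrite derive1E (@derive_val _ _ _ _ _ _ _ (dphi t t0t)).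
  apply: le_trans (proj1 (andP (slope t tI))).
  rewrite ler_peMr ?(ltW k0)// -[leLHS](powRr0 (phi t)).
  by apply: ger_powR; [rewrite phi_gt0|rewrite subr_le0].
have C0 : 0 <= m^-1 * (2 * c) `^ q by rewrite mulr_ge0 ?powR_ge0// invr_ge0 ltW.
have g0 : 0 < 1 + q - m by rewrite subr_gt0.
apply: (@C1_of_slope_vanishing _ _ (wave_slope m q c phi H) t0 e _ _ e0 g0 C0) => //.
- by move=> t tt0; rewrite /wave_slope phi_le// H_le// mulr0 addr0 signed_powR0 mulr0.
- move=> t t0t; apply: cvgM.
    apply: cvgM; first exact: cvg_cst.
    apply: (@continuous_comp _ _ _ phi (@powR R ^~ (1 - m))); first exact: cphi.
    exact/continuous_powR_gt0/phi_gt0.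
  apply: (@continuous_comp _ _ _ (fun t => c * phi t + H t)).
    by apply: cvgD; [apply: cvgM; [exact: cvg_cst|exact: cphi]|exact: cH].
  exact: continuous_signed_powR.
- move=> t tI; have /andP[lo hi] := slope t tI.
  rewrite ger0_norm ?(ger0_norm (phi_ge0 t))//.
  apply: le_trans lo; rewrite mulr_ge0 ?powR_ge0// mulr_ge0 ?powR_ge0//.
  by rewrite invr_ge0 ltW.
Qed.
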